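(* Let $f\in\mathbb{R}[x,y]_{2d}$ be a generic nonnegative binary form of degree $2d$. Let $F\subsetneq\mathrm{Gram}(f)$ be a polyhedral face of dimension $k\geq 1$. Then $\binom{k+3}{2}\leq 2d-2$.
   Context: $\mathbb{R}[x,y]_m$ denotes the space of real binary forms of degree $m$ (together with $0$). A form $f\in\mathbb{R}[x,y]_{2d}$ is nonnegative if $f(a,b)\ge 0$ for all $(a,b)\in\mathbb{R}^2$. A statement about a ''generic nonnegative binary form $f\in\mathbb{R}[x,y]_{2d}$'' means: the set of nonnegative $f\in\mathbb{R}[x,y]_{2d}$ for which the statement (here: the asserted inequality for every proper polyhedral face of dimension $k\ge1$) fails is contained in some (algebraic) hypersurface of the real vector space $\mathbb{R}[x,y]_{2d}$. Let $V=\mathbb{R}[x,y]_d$, let $\mathsf{S}_2V\subseteq V\otimes V$ be the space of symmetric tensors (invariant under $p\otimes q\mapsto q\otimes p$) and let $\mu:\mathsf{S}_2V\to\mathbb{R}[x,y]_{2d}$ be the linear map induced by $p\otimes q\mapsto pq$. A tensor $\theta\in\mathsf{S}_2V$ is positive semidefinite (psd) if $\theta=\sum_{i=1}^r p_i\otimes p_i$ for some $p_1,\dots,p_r\in V$. The (symmetric) Gram spectrahedron is $\mathrm{Gram}(f)=\{\theta\in\mathsf{S}_2V:\theta\text{ psd},\ \mu(\theta)=f\}$, a compact convex set. A face of it is polyhedral if it is a polyhedron. *)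

(* Defs.v *)
From HB Require Import structures.
From mathcomp Require Import all_boot all_order all_algebra.
From mathcomp Require Import boolp classical_sets reals convex.
From mathcomp Require Import mpoly.

Set Implicit Arguments.
Unset Strict Implicit.
Unset Printing Implicit Defensive.

Import Order.TTheory GRing.Theory Num.Theory.

Local Open Scope classical_set_scope.
Local Open Scope ring_scope.

(* R[x,y]_m, with x = 'X_0 and y = 'X_1; it contains 0 and is a vectType. *)
Notation bform R m := (dhomog 2 R m).

(* The exponent of x^(m-i) y^i. *)
Definition bmon (m i : nat) : 'X_{1..2} :=
  [multinom (if j == 0 :> nat then (m - i)%N else i) | j < 2].

Definition bcoef (R : realType) (m : nat) (f : bform R m) (i : 'I_m.+1) : R :=
  (f : {mpoly R[2]})@_(bmon m i).

Definition beval (R : realType) (m : nat) (f : bform R m) (a b : R) : R :=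
  (f : {mpoly R[2]}).@[fun j : 'I_2 => if j == 0 :> nat then a else b].

Definition nonneg_form (R : realType) (m : nat) (f : bform R m) : Prop :=
  forall a b : R, 0 <= beval f a b.

(* Zero locus, in R[x,y]_m, of a nonconstant polynomial in the m + 1
   coefficients of a form; [msize P] is the degree of [P] plus one. *)
Definition hypersurface (R : realType) (m : nat) (Z : set (bform R m)) : Prop :=
  exists P : {mpoly R[m.+1]},
    (1 < msize P)%N /\ Z = [set f | P.@[bcoef f] = 0].

Definition generic_nonneg (R : realType) (m : nat)
    (P : bform R m -> Prop) : Prop :=
  exists Z : set (bform R m),
    hypersurface Z /\ [set f | nonneg_form f /\ ~ P f] `<=` Z.

(* For V = R[x,y]_d, the space V (x) V is identified with the matrices of size
   d + 1: [theta i j] is the coordinate of [theta] on the basis vector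
   x^(d-i)y^i (x) x^(d-j)y^j.  The flip p (x) q |-> q (x) p is then transposition,
   so that S_2 V is the space of symmetric matrices. *)
Notation tensor2 R d := 'M[R]_(d.+1).

Definition tens (R : realType) (d : nat) (p q : bform R d) : tensor2 R d :=
  \matrix_(i, j) (bcoef p i * bcoef q j).

Definition symmetric_tensor (R : realType) (d : nat) (theta : tensor2 R d)
  : Prop := theta^T = theta.

(* The multiplication map; see [mu_tens]. *)
Definition mu (R : realType) (d : nat) (theta : tensor2 R d) : {mpoly R[2]} :=
  \sum_i \sum_j theta i j *: ('X_[bmon d i] * 'X_[bmon d j]).

Definition psd (R : realType) (d : nat) (theta : tensor2 R d) : Prop :=
  exists (r : nat) (p : 'I_r -> bform R d),
    theta = \sum_(i < r) tens (p i) (p i).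

Definition Gram (R : realType) (d : nat) (f : bform R (2 * d))
  : set (tensor2 R d) :=
  [set theta | symmetric_tensor theta /\ psd theta /\
               mu theta = (f : {mpoly R[2]})].

Definition is_face (R : realType) (E : vectType R) (C F : set E) : Prop :=
  [/\ F `<=` C,
      convex_set (F : set (convex_lmodType E)) &
      forall (x y : E) (t : R), C x -> C y -> 0 < t -> t < 1 ->
        F (t *: x + (1 - t) *: y) -> F x /\ F y].

(* A finite intersection of closed half-spaces. *)
Definition polyhedron (R : realType) (E : vectType R) (A : set E) : Prop :=
  exists (n : nat) (l : 'I_n -> {scalar E}) (b : 'I_n -> R),
    A = [set x | forall i : 'I_n, l i x <= b i].

Definition affine_subspace (R : realType) (E : vectType R)
    (x0 : E) (U : {vspace E}) : set E := [set x | x - x0 \in U].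

Definition affine_hull (R : realType) (E : vectType R) (A : set E) : set E :=
  [set x | forall (x0 : E) (U : {vspace E}),
     A `<=` affine_subspace x0 U -> affine_subspace x0 U x].

(* If E is nonzero, the affine hull of the empty set is empty, and the empty set
   has no dimension. *)
Definition has_dim (R : realType) (E : vectType R) (A : set E) (k : nat)
  : Prop :=
  exists (x0 : E) (U : {vspace E}),
    affine_hull A = affine_subspace x0 U /\ \dim U = k.

Lemma bmonE (m : nat) (mm : 'X_{1..2}) :
  mdeg mm = m -> mm = bmon m (mm (lift ord0 ord0)).
Proof.
move=> h; apply/mnmP => j; rewrite mnmE; move: h.
rewrite mdegE big_ord_recl big_ord1 => <-.
case: (unliftP ord0 j) => [k|] -> /=; last by rewrite addnK.
by rewrite (ord1 k).
Qed.

Lemma bmon_inj (m i j : nat) : bmon m i = bmon m j -> i = j.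
Proof. by move/mnmP/(_ (lift ord0 ord0)); rewrite !mnmE. Qed.

Lemma bform_sum (R : realType) (m : nat) (f : bform R m) :
  (f : {mpoly R[2]}) = \sum_(i < m.+1) bcoef f i *: 'X_[bmon m i].
Proof.
apply/mpolyP => mm; rewrite linear_sum /=.
have [hd|hd] := eqVneq (mdeg mm) m; last first.
  rewrite (dhomog_nemf_coeff (dhomog_is_dhomog f)) // big1 // => i _.
  rewrite mcoeffZ mcoeffX; case: eqP => [e|]; last by rewrite mulr0.
  case/eqP: hd; rewrite -e mdegE big_ord_recl big_ord1 !mnmE /=.
  by rewrite subnK // -ltnS.
have hi : (mm (lift ord0 ord0) < m.+1)%N.
  by rewrite ltnS -hd mdegE big_ord_recl big_ord1 leq_addl.
rewrite (bigD1 (Ordinal hi)) //= mcoeffZ mcoeffX -(bmonE hd) eqxx mulr1.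
rewrite big1 ?addr0 /bcoef /= -?(bmonE hd) // => i ne.
rewrite mcoeffZ mcoeffX; case: eqP => [e|]; last by rewrite mulr0.
case/eqP: ne; apply/val_inj => /=; apply: (@bmon_inj m).
by rewrite e -bmonE.
Qed.

Lemma mu_linear (R : realType) (d : nat) : linear (@mu R d).
Proof.
move=> a s t; rewrite /mu scaler_sumr -big_split; apply: eq_bigr => i _ /=.
rewrite scaler_sumr -big_split; apply: eq_bigr => j _ /=.
by rewrite !mxE scalerDl scalerA.
Qed.

Lemma mu_tens (R : realType) (d : nat) (p q : bform R d) :
  mu (tens p q) = (p : {mpoly R[2]}) * (q : {mpoly R[2]}).
Proof.
rewrite (bform_sum p) (bform_sum q) mulr_suml; apply: eq_bigr => i _.
rewrite mulr_sumr; apply: eq_bigr => j _.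
by rewrite mxE -scalerAl -scalerAr scalerA.
Qed.

(* Main.v *)
Require Import Defs.
From HB Require Import structures.
From mathcomp Require Import all_boot all_order all_algebra.
From mathcomp Require Import boolp classical_sets reals convex.
From mathcomp Require Import mpoly.
From mathcomp Require Import ring lra zify.

Set Implicit Arguments.
Unset Strict Implicit.
Unset Printing Implicit Defensive.

Import Order.TTheory GRing.Theory Num.Theory.

Local Open Scope classical_set_scope.
Local Open Scope ring_scope.

(** Let [x] be a relative interior point of a polyhedral face of dimension [k],
    let [r] be its rank and [U] its support. The direction space of the face
    consists of the tensors in [S_2 U] killed by [mu], so that
    [binom (r + 1) 2 - k <= 2 d + 1]; hence the bound follows from [r >= k + 3].
    In a polyhedron every face contains faces of codimension one, and the rank
    drops strictly when passing to a smaller face, which reduces [r >= k + 3] to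
    [r >= 4] for edges. At the two ends of an edge of rank at most three, [f] is
    written as [a p^2 + q^2 = b p^2 + t^2], so that
    [(q - t) (q + t) = (b - a) p^2]. Unique factorization then gives
    [f = g^2 (u^4 + v^4 + c u^2 v^2)] with [deg g + 2 max (deg u) (deg v) <= d].
    Such [f] depend on at most [d + 3] parameters. The face being proper, its
    rank is at most [d], which forces [3 <= d] and so [d + 3 < 2 d + 1]: these
    forms [f] lie in a hypersurface. *)

(** * Algebraic dependence by counting monomials *)

Lemma msizeM_le_pred (K : idomainType) n (p q : {mpoly K[n]}) :
  (msize (p * q) <= (msize p + msize q).-1)%N.
Proof.
have [->|p0] := eqVneq p 0; first by rewrite mul0r msize0.
have [->|q0] := eqVneq q 0; first by rewrite mulr0 msize0.
by rewrite msizeM.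
Qed.

Lemma msize_exp_le (K : idomainType) n e (p : {mpoly K[n]}) k :
  (msize p <= e.+1)%N -> (msize (p ^+ k) <= (k * e).+1)%N.
Proof.
move=> hp; elim: k => [|k IH]; first by rewrite expr0 msize1.
rewrite exprS; apply: leq_trans (msizeM_le_pred _ _) _.
rewrite mulSn; move: (msize p) (msize (p ^+ k)) (k * e)%N hp IH => a b c; lia.
Qed.

Lemma msize_prod_le (K : idomainType) n (I : Type) (s : seq I)
    (F : I -> {mpoly K[n]}) (a : I -> nat) :
  (forall i, (msize (F i) <= (a i).+1)%N) ->
  (msize (\prod_(i <- s) F i) <= (\sum_(i <- s) a i).+1)%N.
Proof.
move=> h; elim: s => [|x s IH]; first by rewrite !big_nil msize1.
rewrite !big_cons; apply: leq_trans (msizeM_le_pred _ _) _.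
move: (msize (F x)) (msize _) (a x) (\sum_(i <- s) a i)%N (h x) IH.
by move=> q1 q2 q3 q4; lia.
Qed.

(* Counting: among the [D ^ m] monomials with exponents below [D], the values
   at [phi] have degree less than [E = O(D)], hence live in a space of dimension
   at most [E ^ n], which is smaller than [D ^ m] for [D] large. *)
Lemma algebraic_dependence (K : fieldType) n m (phi : 'I_m -> {mpoly K[n]}) :
  (n < m)%N ->
  exists2 P : {mpoly K[m]}, P != 0 &
    forall w : 'I_n -> K, P.@[fun i => (phi i).@[w]] = 0.
Proof.
move=> nm.
pose e := (\max_i msize (phi i))%N.
have he i : (msize (phi i) <= e.+1)%N by apply: leqW; apply: leq_bigmax.
(* [D] exceeds [(m e + 1)^n] and [E <= (m e + 1) D], whence [E^n < D^(n + 1) <= D^m]. *)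
pose D := ((m * e).+1 ^ n).+1; pose E := (m * (D * e)).+1.
pose rows := {ffun 'I_m -> 'I_D}; pose cols := {ffun 'I_n -> 'I_E}.
have card_lt : (#|{: cols}| < #|{: rows}|)%N.
  rewrite !card_ffun !card_ord.
  have D0 : (0 < D)%N by [].
  have ED : (E <= (m * e).+1 * D)%N by rewrite /E; nia.
  apply: (@leq_ltn_trans ((m * e).+1 ^ n * D ^ n)).
    by rewrite -expnMn; case: (n) => [|k]; rewrite ?expn0 ?leq_exp2r.
  apply: (@leq_trans (D ^ n.+1)); last by rewrite leq_pexp2l.
  by rewrite expnS ltn_mul2r expn_gt0 D0 /=.
pose mn (a : rows) : 'X_{1..m} := [multinom (a i : nat) | i < m].
pose mc (a : cols) : 'X_{1..n} := [multinom (a i : nat) | i < n].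
pose Q (a : rows) := \prod_i phi i ^+ (a i : nat).
(* Row [a] lists the coefficients of [Q a] at exponents below [E]; with more rows than columns there
   is a nonzero left kernel vector, that is, a linear relation. *)
pose A : 'M[K]_(#|{: rows}|, #|{: cols}|) :=
  \matrix_(i, j) (Q (enum_val i))@_(mc (enum_val j)).
have kA0 : kermx A != 0.
  rewrite -mxrank_eq0 mxrank_ker -lt0n subn_gt0.
  exact: leq_ltn_trans (rank_leq_col A) card_lt.
have /rowV0Pn[v /sub_kermxP vA v0] : kermx A != 0 by [].
pose P : {mpoly K[m]} := \sum_i v 0 i *: 'X_[mn (enum_val i)].
have mn_inj : injective mn.
  move=> a b /mnmP h; apply/ffunP => i; apply: val_inj.
  by have := h i; rewrite !mnmE.
have /rV0Pn[i0 vi0] := v0.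
exists P.
  apply/eqP => /(congr1 (mcoeff (mn (enum_val i0)))).
  rewrite mcoeff0 /P linear_sum (bigD1 i0) //= mcoeffZ mcoeffX eqxx mulr1.
  rewrite big1 ?addr0; first by move/eqP; rewrite (negbTE vi0).
  move=> i ne; rewrite mcoeffZ mcoeffX; case: eqP; last by rewrite mulr0.
  by move/mn_inj/enum_val_inj => e'; rewrite e' eqxx in ne.
have Q0 : \sum_i v 0 i *: Q (enum_val i) = 0.
  apply/mpolyP => mm; rewrite mcoeff0 linear_sum /=.
  case: (boolP [forall i, mm i < E]%N) => [/forallP small|].
    pose b : cols := [ffun i => Ordinal (small i)].
    have mb : mc b = mm by apply/mnmP => i; rewrite mnmE ffunE.
    move/rowP/(_ (enum_rank b)): vA; rewrite !mxE => vb.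
    rewrite -[RHS]vb; apply: eq_bigr => i _.
    by rewrite mcoeffZ !mxE enum_rankK mb.
  (* Outside the box the coefficients vanish by degree: each [Q a] has degree at most [m (D e)],
     which is less than [E]. *)
  rewrite negb_forall => /existsP[j]; rewrite -leqNgt => big.
  apply: big1 => i _; rewrite mcoeffZ memN_msupp_eq0 ?mulr0 //.
  apply: msize_mdeg_ge.
  apply: (@leq_trans E); last first.
    by apply: leq_trans big _; rewrite mdegE (bigD1 j) //= leq_addr.
  have := @msize_prod_le K n _ (index_enum _)
    (fun k => phi k ^+ (enum_val i k : nat)) (fun k => enum_val i k * e)%N.
  move=> /(_ (fun k => msize_exp_le _ (he k))) h; apply: leq_trans h _.
  rewrite ltnS -[m in (m * _)%N]card_ord -sum_nat_const.
  by apply: leq_sum => k _; rewrite leq_mul2r ltnW ?orbT.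
move=> w; have /(congr1 (meval w)) := Q0; rewrite meval0 => <-.
rewrite /P !linear_sum /=; apply: eq_bigr => i _.
rewrite !mevalZ mevalX; congr (_ * _).
by rewrite rmorph_prod; apply: eq_bigr => k _; rewrite rmorphXn mnmE.
Qed.

(** * Two representations by squares, and pencil forms *)

(* In lowest terms [A / p = v / u], so that [A B = c p^2] forces
   [(A, p, B) = g0 (v^2, u v, c u^2)]. *)
Lemma conic_parametrization (K : fieldType) (A B p : {poly K}) (c : K) :
  c != 0 -> p != 0 -> A * B = c%:P * p ^+ 2 ->
  exists u v g : {poly K},
    [/\ A = g * v ^+ 2, p = g * (u * v) & B = c%:P * (g * u ^+ 2)].
Proof.
move=> c0 p0 AB.
have A0 : A != 0.
  apply: contra_neq p0 => A0; move/eqP: AB.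
  by rewrite A0 mul0r eq_sym mulf_eq0 polyC_eq0 (negbTE c0) sqrf_eq0 => /eqP.
pose h := gcdp A p.
have h0 : h != 0 by rewrite gcdp_eq0 negb_and A0.
pose v := A %/ h; pose u := p %/ h.
have Av : A = v * h by rewrite /v divpK ?dvdp_gcdl.
have pu : p = u * h by rewrite /u divpK ?dvdp_gcdr.
have cop : coprimep v u by apply: coprimep_div_gcd; rewrite A0.
have v0 : v != 0 by apply: contra_neq A0 => v0; rewrite Av v0 mul0r.
have vB : v * B = c%:P * (u ^+ 2 * h).
  by apply: (mulfI h0); rewrite mulrA [h * v]mulrC -Av AB pu; ring.
(* Being coprime to [u], the factor [v] must divide [h]; the quotient is the common factor
   sought. *)
have vh : v %| h.
  have : v %| c%:P * (u ^+ 2 * h) by rewrite -vB dvdp_mulIl.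
  rewrite mul_polyC dvdpZr //.
  by rewrite Gauss_dvdpr // coprimep_expr.
pose g := h %/ v.
have hg : h = g * v by rewrite /g divpK.
exists u, v, g; split.
- by rewrite Av hg; ring.
- by rewrite pu hg; ring.
- by apply: (mulfI v0); rewrite vB hg; ring.
Qed.

(** Stated over any commutative ring, so that one formula serves both for actual polynomials and for
    polynomials with indeterminate coefficients; in use, [k] is a constant polynomial. *)
Definition pencil_form (R : comRingType) (g u v : R) (k : R) : R :=
  g ^+ 2 * (v ^+ 4 + u ^+ 4 + k * (u ^+ 2 * v ^+ 2)).

Lemma rmorph_pencil_form (R S : comRingType) (f : {rmorphism R -> S}) g u v k :
  f (pencil_form g u v k) = pencil_form (f g) (f u) (f v) (f k).
Proof. by rewrite /pencil_form !(rmorphM, rmorphD, rmorphXn). Qed.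

Lemma size_mul_sqr_le (K : fieldType) (g v : {poly K}) (d : nat) (c : K) :
  c != 0 -> g != 0 -> (size (c%:P * (g * v ^+ 2))%R <= d.+1)%N ->
  (size v <= ((d - (size g).-1)./2).+1)%N.
Proof.
move=> c0 g0; rewrite mul_polyC size_scale //.
have [->|v0] := eqVneq v 0; first by rewrite size_poly0.
rewrite expr2 !size_mul ?mulf_neq0 //.
have : size g != 0%N by rewrite size_poly_eq0.
have : size v != 0%N by rewrite size_poly_eq0.
by move: (size g) (size v) => a b; lia.
Qed.

(** [h] stands for one half, kept abstract so that the two sides differ by a multiple of
    [h + h - 1]. The second square on the left is that of [q], the half sum of [q - t] and
    [q + t]. *)
Lemma half_square_identity (R : comRingType) (l a b g u v h : R) :
  h + h = 1 ->
  a * (l * g * (u * v)) ^+ 2 +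
    (h * (l * g * v ^+ 2 + (b - a) * (l * g * u ^+ 2))) ^+ 2 =
  (l * h) ^+ 2 * (g ^+ 2 * v ^+ 4) +
    (l * (b - a) * h) ^+ 2 * (g ^+ 2 * u ^+ 4) +
    l ^+ 2 * (a + (b - a) * h) * (g ^+ 2 * (u ^+ 2 * v ^+ 2)).
Proof.
move=> h1; apply/eqP; rewrite -subr_eq0; apply/eqP.
transitivity (l ^+ 2 * (b - a) * h * (h + h - 1) *
              (g ^+ 2 * (u ^+ 2 * v ^+ 2))); first by ring.
by rewrite h1 subrr mulr0 mul0r.
Qed.

(** After parametrizing [q - t], [p] and [q + t], the left side becomes [g^2] times a quadratic form
    in [u^2] and [v^2] whose coefficients at [u^4] and [v^4] are squares; rescaling [u] and [v]
    normalizes both to one. *)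
Lemma two_representations (R : rcfType) (d : nat) (p q t : {poly R}) (a b : R) :
  a != b -> p != 0 -> (size q <= d.+1)%N -> (size t <= d.+1)%N ->
  a%:P * p ^+ 2 + q ^+ 2 = b%:P * p ^+ 2 + t ^+ 2 ->
  exists (g u v : {poly R}) (k : R),
    [/\ g \is monic, ((size g).-1 <= d)%N,
        (size u <= ((d - (size g).-1)./2).+1)%N,
        (size v <= ((d - (size g).-1)./2).+1)%N &
        a%:P * p ^+ 2 + q ^+ 2 = pencil_form g u v k%:P].
Proof.
move=> ab p0 sq st e.
have c0 : b - a != 0 by rewrite subr_eq0 eq_sym.
have AB : (q - t) * (q + t) = (b - a)%:P * p ^+ 2.
  by apply/eqP; rewrite polyCB -subr_eq0; apply/eqP; move: e => /eqP;
     rewrite -subr_eq0 => /eqP e; rewrite -e; ring.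
have [u [v [g0 [Ae pe Be]]]] := conic_parametrization c0 p0 AB.
have g00 : g0 != 0 by apply: contra_neq p0 => g00; rewrite pe g00 mul0r.
have v00 : v != 0 by apply: contra_neq p0 => v0; rewrite pe v0 !mulr0.
pose l := lead_coef g0; have l0 : l != 0 by rewrite lead_coef_eq0.
(* A monic [g] saves one parameter; the leading coefficient [l] is absorbed into [u], [v] and
   [k]. *)
have [g [g0E gm sg]] : exists g, [/\ g0 = l%:P * g, g \is monic & size g = size g0].
  exists (l^-1 *: g0); rewrite size_scale ?invr_eq0 // monicE lead_coefZ mulVf //.
  by rewrite mul_polyC scalerA divff ?scale1r.
have sA : (size (q - t)%R <= d.+1)%N.
  by rewrite (leq_trans (size_polyD _ _)) // size_polyN geq_max sq.
have sB : (size (q + t)%R <= d.+1)%N.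
  by rewrite (leq_trans (size_polyD _ _)) // geq_max sq.
have sqrt4 (x : R) : Num.sqrt `|x| ^+ 4 = x ^+ 2.
  by rewrite (exprM _ 2 2) sqr_sqrtr // real_normK ?num_real.
(* Fourth roots of [(l / 2)^2] and [(l (b - a) / 2)^2], the coefficients of [v^4] and [u^4]. *)
pose s := Num.sqrt `|l / 2|; pose s' := Num.sqrt `|l * (b - a) / 2|.
have s0 : s != 0 by rewrite sqrtr_eq0 -ltNge normr_gt0 mulf_neq0 // invr_eq0 pnatr_eq0.
have s'0 : s' != 0.
  by rewrite sqrtr_eq0 -ltNge normr_gt0 !mulf_neq0 // invr_eq0 pnatr_eq0.
have [k kE] : exists k, l ^+ 2 * (a + (b - a) / 2) = k * (s' ^+ 2 * s ^+ 2).
  exists (l ^+ 2 * (a + (b - a) / 2) / (s' ^+ 2 * s ^+ 2)).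
  by rewrite divfK // mulf_neq0 ?expf_neq0.
exists g, (s' *: u), (s *: v), k.
have su : (size u <= ((d - (size g0).-1)./2).+1)%N.
  by apply: (@size_mul_sqr_le _ g0 u d (b - a)) => //; rewrite -Be.
have sv : (size v <= ((d - (size g0).-1)./2).+1)%N.
  by apply: (@size_mul_sqr_le _ g0 v d 1); rewrite ?oner_eq0 // mul1r -Ae.
rewrite sg; split => //.
- have : (size (g0 * v ^+ 2)%R <= d.+1)%N by rewrite -Ae.
  have : (size g0 <= size (g0 * v ^+ 2)%R)%N.
    by apply: dvdp_leq; rewrite ?dvdp_mulIl // mulf_neq0 ?expf_neq0.
  by move: (size g0) (size _) => x y; lia.
- exact: leq_trans (size_scale_leq _ _) su.
- exact: leq_trans (size_scale_leq _ _) sv.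
have qE : q = 2^-1 *: (g0 * v ^+ 2 + (b - a)%:P * (g0 * u ^+ 2)).
  rewrite -Be -Ae; have -> : q - t + (q + t) = 2%:R *: q.
    by rewrite scaler_nat mulr2n; ring.
  by rewrite scalerA mulVf ?pnatr_eq0 // scale1r.
rewrite /pencil_form !exprZn sqrt4 sqrt4 qE pe g0E -!mul_polyC.
pose X := g ^+ 2 * (u ^+ 2 * v ^+ 2).
transitivity (((l / 2) ^+ 2)%:P * (g ^+ 2 * v ^+ 4) +
  ((l * (b - a) / 2) ^+ 2)%:P * (g ^+ 2 * u ^+ 4) +
  (l ^+ 2 * (a + (b - a) / 2))%:P * X).
  have h3 : (2^-1)%:P + (2^-1)%:P = 1 :> {poly R}.
    by rewrite -polyCD; congr (_%:P); lra.
  rewrite /X !(polyCM, polyCD, polyCN, polyC_exp).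
  exact: half_square_identity.
by rewrite kE /X !(polyCM, polyC_exp); ring.
Qed.

(** * The generic pencil form and its relations *)

Section PencilFamily.
Variables (K : fieldType) (m e : nat).

Let N := (m + e.+1 + e.+1)%N.
Let var (i : nat) : {mpoly K[N.+1]} := 'X_(inord i).

(** Layout of the [N + 1] indeterminates: the [m] lower coefficients of the monic [g], then [e + 1]
    coefficients of [u], [e + 1] of [v], and last the parameter [k]. *)
Let generic_pencil : {poly {mpoly K[N.+1]}} :=
  pencil_form ('X^m + \poly_(i < m) var i)
    (\poly_(i < e.+1) var (m + i)) (\poly_(i < e.+1) var (m + e.+1 + i))
    (var N)%:P.

(** Evaluation at a point is a ring morphism, so it commutes with [pencil_form]; the point lists the
    coefficients of [g], [u], [v] and the value [k]. *)
Lemma generic_pencil_specialize (g u v : {poly K}) (k : K) :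
  g \is monic -> (size g).-1 = m -> (size u <= e.+1)%N -> (size v <= e.+1)%N ->
  exists w : 'I_N.+1 -> K, forall i : nat,
    (generic_pencil`_i).@[w] = (pencil_form g u v k%:P)`_i.
Proof.
move=> gm sg su sv.
pose w0 (j : nat) : K := if (j < m)%N then g`_j else
  if (j < m + e.+1)%N then u`_(j - m)%N else
  if (j < N)%N then v`_(j - (m + e.+1))%N else k.
pose w (j : 'I_N.+1) := w0 j.
have varE j : (j <= N)%N -> (var j).@[w] = w0 j.
  by move=> jN; rewrite mevalXU /w inordK.
exists w => i; rewrite -coef_map; congr (_ `_ i).
have Eg : map_poly (meval w) ('X^m + \poly_(i < m) var i) = g.
  rewrite rmorphD /= map_polyXn; apply/polyP => j.
  have sg' : size g = m.+1 by rewrite -sg prednK // lt0n size_poly_eq0 monic_neq0.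
  rewrite coefD coefXn coef_map coef_poly.
  case: ltngtP => jm /=.
  - by rewrite add0r varE /w0 ?jm // /N; lia.
  - by rewrite add0r rmorph0 nth_default // sg'.
  - rewrite rmorph0 addr0 jm; move: gm; rewrite monicE lead_coefE sg' /=.
    by move/eqP->.
have Eu : map_poly (meval w) (\poly_(i < e.+1) var (m + i)) = u.
  apply/polyP => j; rewrite coef_map coef_poly; case: ifP => je.
    rewrite /= varE /w0 /N; last by lia.
    by rewrite ltnNge leq_addr /= ltn_add2l je addKn.
  by rewrite /= meval0 nth_default // (leq_trans su) // leqNgt je.
have Ev : map_poly (meval w) (\poly_(i < e.+1) var (m + e.+1 + i)) = v.
  apply/polyP => j; rewrite coef_map coef_poly; case: ifP => je.
    rewrite /= varE /w0 /N; last by lia.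
    have -> : (m + e.+1 + j < m)%N = false by lia.
    by rewrite [(_ + j < _ + e.+1)%N]ltnNge leq_addr /= ltn_add2l je addKn.
  by rewrite /= meval0 nth_default // (leq_trans sv) // leqNgt je.
have Ek : map_poly (meval w) (var N)%:P = k%:P.
  rewrite map_polyC /= varE // /w0 /N ltnn.
  by rewrite ltnNge -addnA leq_addr /= ltnNge leq_add2l leq_addr.
by rewrite rmorph_pencil_form /= Eg Eu Ev Ek.
Qed.

Lemma pencil_relation M : (N.+1 < M)%N ->
  exists2 P : {mpoly K[M]}, P != 0 &
    forall (g u v : {poly K}) (k : K),
      g \is monic -> (size g).-1 = m ->
      (size u <= e.+1)%N -> (size v <= e.+1)%N ->
      P.@[fun i => (pencil_form g u v k%:P)`_i] = 0.
Proof.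
move=> NM.
have [P P0 Pv] := algebraic_dependence (fun i : 'I_M => generic_pencil`_i) NM.
exists P => // g u v k gm sg su sv.
have [w hw] := generic_pencil_specialize k gm sg su sv.
by rewrite -[RHS](Pv w); apply: meval_eq => i; rewrite hw.
Qed.

End PencilFamily.

(* A pencil form with [deg g = m] depends on [m + 2 (e + 1) + 1 <= d + 3]
   parameters, against the [2 d + 1] coefficients of a form. *)
Lemma pencil_hypersurface (K : fieldType) d : (3 <= d)%N ->
  exists2 P : {mpoly K[(2 * d).+1]}, (1 < msize P)%N &
    forall (g u v : {poly K}) (k : K),
      g \is monic -> ((size g).-1 <= d)%N ->
      (size u <= ((d - (size g).-1)./2).+1)%N ->
      (size v <= ((d - (size g).-1)./2).+1)%N ->
      P.@[fun i => (pencil_form g u v k%:P)`_i] = 0.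
Proof.
move=> d3.
have small (m : 'I_d.+1) :
    ((m + ((d - m)./2).+1 + ((d - m)./2).+1).+1 < (2 * d).+1)%N.
  by case: m => m /= ?; lia.
have rel (m : 'I_d.+1) := pencil_relation K (small m).
pose P m := s2val (cid2 (rel m)).
(* The product over all degrees [m] of [g] handles every degree at once. *)
pose Q : {mpoly K[(2 * d).+1]} := \prod_m P m.
have Q0 : Q != 0 by apply/prodf_neq0 => m _; exact: s2valP (cid2 (rel m)).
have Qv (g u v : {poly K}) (k : K) :
      g \is monic -> ((size g).-1 <= d)%N ->
      (size u <= ((d - (size g).-1)./2).+1)%N ->
      (size v <= ((d - (size g).-1)./2).+1)%N ->
      Q.@[fun i => (pencil_form g u v k%:P)`_i] = 0.
  move=> gm sg su sv; pose m : 'I_d.+1 := Ordinal (sg : ((size g).-1 < d.+1)%N).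
  rewrite /Q (bigD1 m) //= mevalM.
  by rewrite (s2valP' (cid2 (rel m))) ?mul0r.
(* A nonzero constant would not vanish at the pencil form with [g = 1], [u = v = 0], [k = 0]. *)
exists Q => //; rewrite ltnNge; apply: contra Q0 => /msize1_polyC Qc.
have := Qv 1 0 0 0; rewrite rpred1 size_poly1 size_poly0 => /(_ isT isT isT isT).
by rewrite Qc mevalC => ->; rewrite mpolyC0.
Qed.

(** * Positive semidefinite matrices *)

(** Semidefiniteness by the sign of the quadratic form, with vectors written as rows; [psdP]
    identifies it with sums of squares. *)
Definition qpsd (R : realFieldType) n (M : 'M[R]_n) : Prop :=
  M^T = M /\ forall v : 'rV_n, 0 <= (v *m M *m v^T) 0 0.

Lemma sqr_norm_row (R : realFieldType) n (v : 'rV[R]_n) :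
  (v *m v^T) 0 0 = \sum_i v 0 i ^+ 2.
Proof. by rewrite mxE; apply: eq_bigr => i _; rewrite mxE expr2. Qed.

Lemma gram_qpsd (R : realFieldType) m n (B : 'M[R]_(m, n)) : qpsd (B^T *m B).
Proof.
split=> [|v]; first by rewrite trmx_mul trmxK.
have -> : v *m (B^T *m B) *m v^T = (v *m B^T) *m (v *m B^T)^T.
  by rewrite trmx_mul trmxK !mulmxA.
by rewrite sqr_norm_row sumr_ge0 // => i _; exact: sqr_ge0.
Qed.

Lemma gram_eq0 (R : realFieldType) m n (B : 'M[R]_(m, n)) :
  B^T *m B = 0 -> B = 0.
Proof.
move=> h; apply/matrixP => i j; rewrite mxE; apply/eqP.
move/matrixP/(_ j j): h; rewrite !mxE => /eqP.
rewrite psumr_eq0 => [/allP/(_ i (mem_index_enum _))|k _].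
  by rewrite !mxE /= -expr2 sqrf_eq0.
by rewrite !mxE -expr2 sqr_ge0.
Qed.

(** If [C] spans the cokernel of [B^T B], then [(B C)^T (B C) = 0], so [B C = 0]. *)
Lemma gram_row_space (R : realFieldType) m n (B : 'M[R]_(m, n)) :
  (B <= B^T *m B)%MS.
Proof.
rewrite submxE; apply/eqP/gram_eq0; set C := cokermx _.
by rewrite trmx_mul -!mulmxA [_ *m (B *m C)]mulmxA mulmx_coker mulmx0.
Qed.

Lemma qpsd_add_delta (R : realFieldType) n (M : 'M[R]_n) (v : 'rV_n) i (s : R) :
  M^T = M ->
  ((v + s *: delta_mx 0 i) *m M *m (v + s *: delta_mx 0 i)^T) 0 0 =
  (v *m M *m v^T) 0 0 + s * ((v *m M) 0 i) *+ 2 + s ^+ 2 * M i i.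
Proof.
move=> Ms.
set e : 'rV[R]_n := delta_mx 0 i.
have Ei (u : 'rV[R]_n) : (u *m e^T) 0 0 = u 0 i.
  by rewrite trmx_delta -colE mxE.
have Ei' (u : 'rV[R]_n) : (e *m M *m u^T) 0 0 = (u *m M) 0 i.
  have -> : e *m M *m u^T = (u *m M *m e^T)^T.
    by rewrite !trmx_mul trmxK Ms mulmxA.
  by rewrite mxE Ei.
rewrite linearD linearZ /= !mulmxDl !mulmxDr -!scalemxAl -!scalemxAr.
have D (A B : 'M[R]_1) : (A + B) 0 0 = A 0 0 + B 0 0 by rewrite mxE.
have Z a (A : 'M[R]_1) : (a *: A) 0 0 = a * A 0 0 by rewrite mxE.
by rewrite !(D, Z) Ei' !Ei /e -rowE [row i M 0 i]mxE; ring.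
Qed.

Lemma qpsd_diag_ge0 (R : realFieldType) n (M : 'M[R]_n) i : qpsd M -> 0 <= M i i.
Proof.
case=> Ms /(_ (0 + 1 *: delta_mx 0 i)); rewrite qpsd_add_delta //.
by rewrite !mul0mx !mxE; lra.
Qed.

(** With zero diagonal, the form at [e_i + s e_j] is [2 s M i j], which is nonnegative for [s = 1]
    and [s = -1] only if it is zero. *)
Lemma qpsd_diag_eq0 (R : realFieldType) n (M : 'M[R]_n) :
  qpsd M -> (forall i, M i i = 0) -> M = 0.
Proof.
case=> Ms Mp d0; apply/matrixP => i j; rewrite [RHS]mxE.
have e s : 0 <= s * M i j *+ 2.
  have := Mp (delta_mx 0 i + s *: delta_mx 0 j).
  by rewrite qpsd_add_delta // d0 mulr0 addr0 -rowE trmx_delta -colE !mxE d0 add0r.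
have := e 1; have := e (- 1); lra.
Qed.

(** Induction on the rank bound: subtracting the rank-one matrix built on a nonzero diagonal entry
    leaves a semidefinite matrix of smaller rank. *)
Lemma cholesky (R : rcfType) n r (M : 'M[R]_n) :
  qpsd M -> (\rank M <= r)%N -> exists B : 'M[R]_(r, n), M = B^T *m B.
Proof.
elim: r M => [|r IH] M Mp.
  by rewrite leqn0 mxrank_eq0 => /eqP ->; exists 0; rewrite mulmx0.
have [[i Mi]|M0] := pselect (exists i, M i i != 0); last first.
  move=> _; exists 0; rewrite mulmx0; apply: qpsd_diag_eq0 => // i.
  by apply/eqP; apply: contra_notT M0 => Mi; exists i.
move=> rM; have Mi0 : 0 < M i i by rewrite lt_neqAle eq_sym Mi qpsd_diag_ge0.
have [Ms Mq] := Mp.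
pose c : 'rV_n := row i M; pose M' := M - (M i i)^-1 *: (c^T *m c).
have cv (v : 'rV_n) : v *m c^T = ((v *m M) 0 i)%:M.
  by rewrite /c tr_row Ms colE mulmxA -colE [LHS]mx11_scalar mxE.
have M'p : qpsd M'.
  split=> [|v].
    by rewrite /M' linearB linearZ /= trmx_mul trmxK Ms.
  (* This multiple of the [i]-th basis vector minimizes the form of [M] along that direction, and
     the minimum is the form of [M'] at [v]. *)
  have := Mq (v + (- (v *m M) 0 i / M i i) *: delta_mx 0 i).
  have -> : (v *m M' *m v^T) 0 0 =
            (v *m M *m v^T) 0 0 - (M i i)^-1 * (v *m M) 0 i ^+ 2.
    rewrite /M' mulmxBr mulmxBl -scalemxAr -scalemxAl mulmxA cv mul_scalar_mx.
    rewrite -scalemxAl -[c *m v^T]trmxK trmx_mul trmxK cv tr_scalar_mx !mxE.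
    by rewrite mulr1n expr2.
  rewrite qpsd_add_delta //.
  set a := (v *m M) 0 i; set b := (_ *m _) 0 0 => h; apply: le_trans h _.
  by rewrite le_eqVlt; apply/orP; left; apply/eqP; field.
have M'i : col i M' = 0.
  apply/colP => j; rewrite !mxE big_ord1 !mxE mulrA.
  have -> : M i j = M j i by rewrite -{1}Ms mxE.
  by rewrite [_^-1 * _]mulrC divfK // subrr.
have cM : (c <= M)%MS by apply: row_sub.
have sub : (M' <= M)%MS.
  by rewrite addmx_sub // eqmx_opp scalemx_sub // (submx_trans (submxMl _ _)).
(* The rank drops because column [i] vanishes in [M'] but not in [M]. *)
have rM' : (\rank M' <= r)%N.
  rewrite -ltnS (leq_trans _ rM) // ltn_neqAle (mxrankS sub) andbT.
  apply/negP => eqr; have : (M <= M')%MS.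
    by rewrite -(geq_leqif (mxrank_leqif_sup sub)) (eqP eqr).
  case/submxP => X MX; have : col i M = 0 by rewrite MX colE -mulmxA -colE M'i mulmx0.
  by move/colP/(_ i); rewrite !mxE => Mi'; rewrite Mi' eqxx in Mi.
have [B' M'B] := IH M' M'p rM'.
pose C : 'M_(1 + r, n) := col_mx ((Num.sqrt (M i i))^-1 *: c) B'.
suff : C^T *m C = M by exists C.
rewrite tr_col_mx mul_row_col -M'B.
have -> : ((Num.sqrt (M i i))^-1 *: c)^T = (Num.sqrt (M i i))^-1 *: c^T.
  by rewrite linearZ.
rewrite -scalemxAl -scalemxAr scalerA.
by rewrite -invfM -expr2 sqr_sqrtr ?ltW // addrC subrK.
Qed.

Lemma qpsd_isotropic (R : rcfType) n (M : 'M[R]_n) (v : 'rV_n) :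
  qpsd M -> (v *m M *m v^T) 0 0 = 0 -> v *m M = 0.
Proof.
move=> Mp; have [B ->] := cholesky Mp (leqnn _).
move=> h; have : (v *m B^T)^T = 0.
  apply: gram_eq0; rewrite trmxK trmx_mul trmxK.
  by apply/matrixP => i j; rewrite !ord1 [RHS]mxE -[RHS]h !mulmxA.
by move/(congr1 trmx); rewrite trmxK trmx0 mulmxA => ->; rewrite mul0mx.
Qed.

Lemma qpsdD (R : realFieldType) n (M N : 'M[R]_n) :
  qpsd M -> qpsd N -> qpsd (M + N).
Proof.
case=> Ms Mp [Ns Np]; split=> [|v]; first by rewrite linearD /= Ms Ns.
by rewrite mulmxDr mulmxDl mxE addr_ge0.
Qed.

Lemma qpsdZ (R : realFieldType) n (M : 'M[R]_n) a :
  0 <= a -> qpsd M -> qpsd (a *: M).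
Proof.
move=> a0 [Ms Mp]; split=> [|v]; first by rewrite linearZ /= Ms.
by rewrite -scalemxAr -scalemxAl mxE mulr_ge0.
Qed.

(** On the kernel of [M + N] both forms are nonnegative with zero sum, so its vectors are isotropic
    for [M] and hence in the kernel of [M]. *)
Lemma qpsd_addl_sub (R : rcfType) n (M N : 'M[R]_n) :
  qpsd M -> qpsd N -> (M <= (M + N)%R)%MS.
Proof.
move=> Mp Np; rewrite submxE; set C := cokermx _.
have CMN : C^T *m (M + N) = 0.
  have [<- _] := qpsdD Mp Np.
  by rewrite -trmx_mul mulmx_coker trmx0.
have : C^T *m M = 0.
  apply/row_matrixP => i; rewrite row0 row_mul; set v := row i _.
  have vMN : v *m (M + N) = 0 by rewrite -row_mul CMN row0.
  apply: qpsd_isotropic => //.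
  have := congr1 (fun X => (X *m v^T) 0 0) vMN.
  rewrite /= mul0mx mulmxDr mulmxDl [X in X = _ -> _]mxE [X in _ = X -> _]mxE => /eqP.
  have [_ /(_ v) m0] := Mp; have [_ /(_ v) n0] := Np.
  by rewrite paddr_eq0 // => /andP[/eqP].
move/(congr1 trmx); rewrite trmx_mul trmxK trmx0; case: Mp => -> _ ->.
exact/eqP.
Qed.

Lemma quadratic_bound (R : realFieldType) n (S : 'M[R]_n) (u : 'rV_n) :
  `|(u *m S *m u^T) 0 0| <= (\sum_i \sum_j `|S i j|) * (u *m u^T) 0 0.
Proof.
have -> : (u *m S *m u^T) 0 0 = \sum_i \sum_j S i j * (u 0 i * u 0 j).
  rewrite mxE exchange_big; apply: eq_bigr => j _ /=.
  by rewrite !mxE mulr_suml; apply: eq_bigr => i _; ring.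
apply: le_trans (ler_norm_sum _ _ _) _; rewrite mulr_suml.
apply: ler_sum => i _; apply: le_trans (ler_norm_sum _ _ _) _; rewrite mulr_suml.
apply: ler_sum => j _; rewrite normrM ler_wpM2l //.
rewrite sqr_norm_row.
have le1 k : u 0 k ^+ 2 <= \sum_l u 0 l ^+ 2.
  by rewrite (bigD1 k) //= lerDl sumr_ge0 // => l _; exact: sqr_ge0.
have := le1 i; have := le1 j; move: (\sum_l _) (u 0 i) (u 0 j) => s x y.
have := sqr_ge0 (x - y); have := sqr_ge0 (x + y); case: ler0P; nra.
Qed.

(** Writing [M = B^T B] and [N = B^T S B], the form of [N] is bounded by [K] times that of [M]. The
    step [1 / (K + 1)] is then small enough, also when [K = 0]. *)
Lemma qpsd_perturb (R : rcfType) n (M N : 'M[R]_n) :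
  qpsd M -> N^T = N -> (N <= M)%MS ->
  exists2 e : R, 0 < e & qpsd (M + e *: N) /\ qpsd (M - e *: N).
Proof.
move=> Mp Ns NM.
have [r [B MB]] : exists r (B : 'M_(r, n)), M = B^T *m B.
  by exists (\rank M); exact: cholesky.
have NB : (N <= B)%MS by apply: submx_trans NM _; rewrite MB submxMl.
have [P NPB] : exists P, N *m P *m B = N by exists (pinvmx B); rewrite mulmxKpV.
pose S := P^T *m N *m P.
have NE : N = B^T *m S *m B.
  have e : B^T *m P^T *m N = N.
    by rewrite -trmx_mul -{1}Ns -trmx_mul mulmxA NPB.
  by rewrite /S !mulmxA e NPB.
pose K := \sum_i \sum_j `|S i j|.
have K0 : 0 <= K by rewrite sumr_ge0 // => i _; rewrite sumr_ge0.
have Nb (v : 'rV_n) : `|(v *m N *m v^T) 0 0| <= K * (v *m M *m v^T) 0 0.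
  have -> : v *m N *m v^T = (v *m B^T) *m S *m (v *m B^T)^T.
    by rewrite NE trmx_mul trmxK !mulmxA.
  have -> : v *m M *m v^T = (v *m B^T) *m (v *m B^T)^T.
    by rewrite MB trmx_mul trmxK !mulmxA.
  exact: quadratic_bound.
have K1 : 0 < K + 1 by rewrite ltr_wpDl.
have key s : `|s| = (K + 1)^-1 -> qpsd (M + s *: N).
  move=> sK; have [Ms Mq] := Mp; split=> [|v].
    by rewrite linearD linearZ /= Ms Ns.
  rewrite mulmxDr mulmxDl -scalemxAr -scalemxAl [X in 0 <= X]mxE.
  rewrite [X in _ + X]mxE -lerBlDl sub0r lerNl; apply: le_trans (ler_norm _) _.
  rewrite normrN normrM sK ler_pdivrMl //; apply: le_trans (Nb v) _.
  by rewrite ler_wpM2r // lerDl.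
have Ki : `|(K + 1)^-1| = (K + 1)^-1 by rewrite gtr0_norm ?invr_gt0.
exists (K + 1)^-1; rewrite ?invr_gt0 // -scaleNr.
by split; apply: key; rewrite ?normrN.
Qed.

(** * Tensors as univariate polynomials *)

(** The dehomogenization of [mu t] at [x = 1], [y = 'X]; univariate polynomials give access to gcds
    and to counting roots. *)
Definition tpoly (R : realType) (d : nat) (t : tensor2 R d) : {poly R} :=
  \sum_i \sum_j t i j *: 'X^(i + j).

Lemma tpoly_is_linear (R : realType) d : linear (@tpoly R d).
Proof.
move=> a s t; rewrite /tpoly scaler_sumr -big_split; apply: eq_bigr => i _ /=.
rewrite scaler_sumr -big_split; apply: eq_bigr => j _ /=.
by rewrite !mxE scalerDl scalerA.
Qed.

HB.instance Definition _ (R : realType) d :=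
  GRing.isLinear.Build R (tensor2 R d) {poly R} _ (@tpoly R d)
    (@tpoly_is_linear R d).

HB.instance Definition _ (R : realType) d :=
  GRing.isLinear.Build R (tensor2 R d) {mpoly R[2]} _ (@mu R d)
    (@mu_linear R d).

Lemma size_tpoly (R : realType) d (t : tensor2 R d) :
  (size (tpoly t) <= (2 * d).+1)%N.
Proof.
apply: (leq_trans (size_sum _ _ _)); apply/bigmax_leqP => i _.
apply: (leq_trans (size_sum _ _ _)); apply/bigmax_leqP => j _.
rewrite (leq_trans (size_scale_leq _ _)) // size_polyXn.
by have := ltn_ord i; have := ltn_ord j; rewrite !ltnS; lia.
Qed.

Lemma mdeg_bmon (m i : nat) : (i <= m)%N -> mdeg (bmon m i) = m.
Proof. by move=> im; rewrite mdegE big_ord_recl big_ord1 !mnmE /= subnK. Qed.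

Lemma bmonD (m n i j : nat) : (i <= m)%N -> (j <= n)%N ->
  (bmon m i + bmon n j)%MM = bmon (m + n) (i + j).
Proof. by move=> im jn; apply/mnmP => k; rewrite mnmDE !mnmE; case: ifP => _; lia. Qed.

Lemma mu_tpoly (R : realType) d (t : tensor2 R d) :
  mu t = \sum_(k < (2 * d).+1) (tpoly t)`_k *: 'X_[bmon (2 * d) k].
Proof.
under [RHS]eq_bigr => k _ do rewrite /tpoly coef_sum scaler_suml.
rewrite exchange_big; apply: eq_bigr => i _ /=.
under [RHS]eq_bigr => k _ do rewrite coef_sum scaler_suml.
rewrite exchange_big; apply: eq_bigr => j _ /=.
have hij : (i + j < (2 * d).+1)%N.
  by have := ltn_ord i; have := ltn_ord j; lia.
rewrite (bigD1 (Ordinal hij)) //= coefZ coefXn eqxx mulr1 big1 ?addr0.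
  have im : (i <= d)%N by rewrite -ltnS.
  have jm : (j <= d)%N by rewrite -ltnS.
  by rewrite -mpolyXD (bmonD im jm) mul2n addnn.
move=> k ne; rewrite coefZ coefXn; case: eqP => [e|]; last by rewrite mulr0 scale0r.
by case/eqP: ne; apply: val_inj.
Qed.

Lemma tpoly_eq0_mu (R : realType) d (t : tensor2 R d) : tpoly t = 0 -> mu t = 0.
Proof.
by move=> t0; rewrite mu_tpoly t0 big1 // => k _; rewrite coef0 scale0r.
Qed.

Lemma tpoly_coef (R : realType) d (t : tensor2 R d) (k : 'I_(2 * d).+1) :
  (tpoly t)`_k = (mu t)@_(bmon (2 * d) k).
Proof.
rewrite mu_tpoly linear_sum (bigD1 k) //= mcoeffZ mcoeffX eqxx mulr1.
rewrite big1 ?addr0 // => i ne; rewrite mcoeffZ mcoeffX.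
case: eqP => [/bmon_inj e|]; last by rewrite mulr0.
by case/eqP: ne; apply: val_inj.
Qed.

Lemma mu_eq_tpoly (R : realType) d (s t : tensor2 R d) :
  mu s = mu t -> tpoly s = tpoly t.
Proof.
move=> st; apply/polyP => k; case: (ltnP k (2 * d).+1) => hk.
  by rewrite (tpoly_coef s (Ordinal hk)) st -tpoly_coef.
by rewrite !nth_default // (leq_trans (size_tpoly _)).
Qed.

Lemma rVpoly_sum (R : nzRingType) n (u : 'rV[R]_n) :
  rVpoly u = \sum_i u 0 i *: 'X^i.
Proof.
rewrite {1}[u]row_sum_delta linear_sum; apply: eq_bigr => i _.
by rewrite linearZ /= rVpoly_delta.
Qed.

Lemma tpoly_rank1 (R : realType) d (u w : 'rV[R]_d.+1) :
  tpoly (u^T *m w) = rVpoly u * rVpoly w.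
Proof.
rewrite !rVpoly_sum mulr_suml; apply: eq_bigr => i _.
rewrite mulr_sumr; apply: eq_bigr => j _.
by rewrite !mxE big_ord1 !mxE -scalerAl -scalerAr scalerA exprD.
Qed.

Lemma gram_sum_rows (R : comNzRingType) m n (B : 'M[R]_(m, n)) :
  B^T *m B = \sum_i (row i B)^T *m row i B.
Proof.
apply/matrixP => i j; rewrite summxE mxE; apply: eq_bigr => k _.
by rewrite !mxE big_ord1 !mxE.
Qed.

Lemma poly_horner_eq0 (R : numDomainType) (p : {poly R}) :
  (forall x, p.[x] = 0) -> p = 0.
Proof.
move=> p0; apply/eqP; apply: contraT => pn0.
have := @max_poly_roots R p [seq i%:R | i <- iota 0 (size p)] pn0.
rewrite size_map size_iota ltnn => h; rewrite h //.
  by apply/allP => x _; rewrite /root p0.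
by rewrite map_inj_uniq ?iota_uniq // => i j /eqP; rewrite eqr_nat => /eqP.
Qed.

(** By a Gram factorization [tpoly t] is a sum of squares, and a sum of squares vanishing at every
    real point vanishes term by term. This is what makes Gram spectrahedra free of rays. *)
Lemma qpsd_tpoly_eq0 (R : realType) d (t : tensor2 R d) :
  qpsd t -> tpoly t = 0 -> t = 0.
Proof.
move=> tp; have [B ->] := cholesky tp (leqnn _).
rewrite gram_sum_rows linear_sum /= => s0; apply: big1 => i _.
suff -> : row i B = 0 by rewrite mulmx0.
apply: (can_inj rVpolyK); rewrite linear0; apply: poly_horner_eq0 => x.
have /eqP := congr1 (horner^~ x) s0; rewrite horner0 horner_sum psumr_eq0.
  move=> /allP/(_ i (mem_index_enum _)).
  by rewrite tpoly_rank1 hornerM /= -expr2 sqrf_eq0 => /eqP.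
by move=> j _; rewrite tpoly_rank1 hornerM -expr2 sqr_ge0.
Qed.

Lemma row_bform (R : realType) d (u : 'rV[R]_d.+1) :
  exists p : bform R d, forall i, bcoef p i = u 0 i.
Proof.
pose q : {mpoly R[2]} := \sum_i u 0 i *: 'X_[bmon d i].
have hq : q \is d.-homog.
  apply: rpred_sum => i _; apply: rpredZ; rewrite dhomogX.
  by apply/eqP/mdeg_bmon; rewrite -ltnS.
exists (DHomog hq) => i; rewrite /bcoef /= linear_sum (bigD1 i) //=.
rewrite mcoeffZ mcoeffX eqxx mulr1 big1 ?addr0 // => j ne.
rewrite mcoeffZ mcoeffX; case: eqP => [/bmon_inj e|]; last by rewrite mulr0.
by case/eqP: ne; apply: val_inj.
Qed.

Lemma psdP (R : realType) d (t : tensor2 R d) : psd t <-> qpsd t.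
Proof.
split=> [[r [p ->]]|/cholesky/(_ (leqnn _))[B tB]].
  suff -> : \sum_i tens (p i) (p i) =
     (\matrix_(i, j) bcoef (p i) j)^T *m \matrix_(i, j) bcoef (p i) j.
    exact: gram_qpsd.
  apply/matrixP => i j; rewrite summxE mxE; apply: eq_bigr => k _.
  by rewrite !mxE.
have /choice[p hp] : forall i, exists p : bform R d, forall j, bcoef p j = B i j.
  move=> i; have [p hp] := row_bform (row i B).
  by exists p => j; rewrite hp mxE.
exists (\rank t), p; rewrite {1}tB; apply/matrixP => i j; rewrite summxE mxE.
by apply: eq_bigr => k _; rewrite !mxE !hp.
Qed.

Lemma GramP (R : realType) d (f : bform R (2 * d)) (t : tensor2 R d) :
  Gram f t <-> qpsd t /\ mu t = (f : {mpoly R[2]}).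
Proof.
split=> [[_ [/psdP]]|[tp tf]] //; split; first by case: tp.
by split=> //; apply/psdP.
Qed.

(** * Dimension count on the support of a tensor *)

Lemma card_le_pairs r :
  #|[set p : 'I_r * 'I_r | (p.1 <= p.2)%N]%SET| = 'C(r.+1, 2).
Proof.
rewrite -sum1dep_card -(pair_big_dep xpredT (fun i j : 'I_r => i <= j)%N (fun _ _ => 1%N)) /=.
rewrite (exchange_big_dep xpredT) //= -bin2_sum big_nat_recl // add0n.
rewrite big_mkord; apply: eq_bigr => j _.
have := @big_ord_widen _ 0%N addn _ r (fun=> 1%N) (ltn_ord j).
by rewrite sum_nat_const card_ord muln1.
Qed.

(** The tensors [B^T S B] with [S] symmetric of size [r] form a space of dimension ['C(r + 1, 2)];
    the [2 d + 1] coefficient equations cut out a subspace of [W]. *)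
Lemma rank_face_dim (R : realType) d (x : tensor2 R d) (W : {vspace tensor2 R d}) :
  qpsd x ->
  (forall N : tensor2 R d, N^T = N -> (N <= x)%MS -> mu N = 0 -> N \in W) ->
  ('C((\rank x).+1, 2) <= (2 * d).+1 + \dim W)%N.
Proof.
move=> xp hW.
have [r [B [xB rB]]] : exists r (B : 'M_(r, d.+1)), x = B^T *m B /\ \rank x = r.
  by have [B xB] := cholesky xp (leqnn _); exists (\rank x), B.
have freeB : row_free B.
  by rewrite /row_free eqn_leq rank_leq_row -{1}rB xB mxrankM_maxr.
rewrite rB -card_le_pairs; set A := [set p | _]%SET.
pose ij (k : 'I_#|A|) := enum_val k.
(* For a diagonal pair the summand is twice a matrix unit, which is harmless in characteristic
   zero. *)
pose S (c : 'rV[R]_#|A|) : 'M[R]_r :=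
  \sum_k c 0 k *: (delta_mx (ij k).1 (ij k).2 + delta_mx (ij k).2 (ij k).1).
pose psi (c : 'rV[R]_#|A|) : tensor2 R d := B^T *m S c *m B.
pose a (c : 'rV[R]_#|A|) : 'rV[R]_(2 * d).+1 := poly_rV (tpoly (psi c)).
have S_lin : linear S.
  move=> k u v; rewrite /S scaler_sumr -big_split; apply: eq_bigr => i _ /=.
  by rewrite !mxE scalerDl scalerA.
have psi_lin : linear psi.
  by move=> k u v; rewrite /psi S_lin mulmxDr mulmxDl -scalemxAr -scalemxAl.
have a_lin : linear a by move=> k u v; rewrite /a psi_lin !linearP.
pose psi_ := GRing.isLinear.Build _ _ _ _ psi psi_lin.
pose a_ := GRing.isLinear.Build _ _ _ _ a a_lin.
pose psiL : {linear 'rV[R]_#|A| -> tensor2 R d} := HB.pack psi psi_.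
pose aL : {linear 'rV[R]_#|A| -> 'rV[R]_(2 * d).+1} := HB.pack a a_.
have psi_inj (c : 'rV[R]_#|A|) : psi c = 0 -> c = 0.
  move=> pc0; have SB : S c *m B = 0.
    apply: trmx_inj; apply: (row_free_inj freeB).
    have -> : (S c *m B)^T *m B = (psi c)^T by rewrite /psi !trmx_mul trmxK !mulmxA.
    by rewrite pc0 !trmx0 mul0mx.
  have S0 : S c = 0 by apply: (row_free_inj freeB); rewrite SB mul0mx.
  apply/rowP => k; rewrite mxE; have := congr1 (fun M : 'M_r => M (ij k).1 (ij k).2) S0.
  rewrite /= summxE mxE (bigD1 k) //= big1 ?addr0 => [|l lk].
    rewrite !mxE !eqxx /= => /eqP; rewrite mulf_eq0 => /orP[/eqP //|].
    by rewrite -natrD pnatr_eq0.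
  have ijne : ij l != ij k by apply: contra lk => /eqP/enum_val_inj ->.
  (* Two ordered pairs that are transposes of each other are equal and diagonal, so [l] contributes
     nothing at entry [ij k]. *)
  have := enum_valP k; have := enum_valP l; rewrite !inE -!/(ij _) !mxE.
  move: ijne; case: (ij l) (ij k) => [l1 l2] [k1 k2] /=; rewrite xpair_eqE => ne le1 le2.
  rewrite [k1 == l1]eq_sym [k2 == l2]eq_sym (negbTE ne) add0r.
  case: (eqVneq k1 l2) => [e1|]; last by rewrite mulr0.
  case: (eqVneq k2 l1) => [e2|]; last by rewrite mulr0.
  move: ne; rewrite e1 e2 in le2 *; have -> : l1 = l2.
    by apply: val_inj; apply/eqP; rewrite eqn_leq le1.
  by rewrite eqxx.
have dim_rV n : \dim {:'rV[R]_n} = n by rewrite dimvf; exact: mul1n.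
have := limg_ker_dim (linfun aL) fullv; rewrite capfv dim_rV.
have <- : \dim (linfun psiL @: lker (linfun aL)) = \dim (lker (linfun aL)).
  apply: limg_dim_eq; apply/eqP; rewrite -subv0; apply/subvP => c.
  rewrite memv_cap !memv_ker !lfunE /= => /andP[_ /eqP pc].
  by rewrite memv0; apply/eqP; exact: psi_inj.
have h1 : (\dim (linfun psiL @: lker (linfun aL)) <= \dim W)%N.
  apply: dimvS; apply/subvP => N /memv_imgP[c]; rewrite memv_ker !lfunE /= => /eqP ac ->.
  have Ss : (S c)^T = S c.
    rewrite /S linear_sum; apply: eq_bigr => k _ /=.
    by rewrite linearZ linearD /= !trmx_delta addrC.
  apply: hW.
  - by rewrite /psi !trmx_mul trmxK Ss mulmxA.
  - by apply: submx_trans (submxMl _ _) _; rewrite xB gram_row_space.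
  - apply: tpoly_eq0_mu; rewrite -[tpoly _](@poly_rV_K _ (2 * d).+1) ?size_tpoly //.
    by rewrite -/(a c) ac linear0.
have h2 : (\dim (linfun aL @: fullv) <= (2 * d).+1)%N.
  by rewrite -[X in (_ <= X)%N]dim_rV dimvS ?subvf.
lia.
Qed.

(** * Polyhedra and their minimal faces through a point *)

Section Polyhedron.
Variables (R : realType) (E : vectType R) (n : nat).
Variables (l : 'I_n -> {scalar E}) (b : 'I_n -> R).
Implicit Types (x y u v w : E) (i j : 'I_n).

Let P : set E := [set x | forall i, l i x <= b i].

Lemma form_lfun_exists (h : {scalar E}) :
  exists g : 'Hom(E, R^o), forall v, g v = h v.
Proof.
have h_lin : linear (h : E -> R^o) by move=> a u v; rewrite linearP.
pose h_ := GRing.isLinear.Build _ _ _ _ (h : E -> R^o) h_lin.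
pose hL : {linear E -> R^o} := HB.pack (h : E -> R^o) h_.
by exists (linfun hL) => v; rewrite lfunE.
Qed.

(** Bundled as a linear map, so that its kernel is available as a subspace. *)
Definition form_lfun (h : {scalar E}) : 'Hom(E, R^o) :=
  proj1_sig (cid (form_lfun_exists h)).

Lemma form_lfunE (h : {scalar E}) v : form_lfun h v = h v.
Proof. exact: (proj2_sig (cid (form_lfun_exists h))). Qed.

(* The space of the directions along which [x] can be moved both ways
   inside the polyhedron. *)
Definition lineality x : {vspace E} :=
  (\bigcap_(i | l i x == b i) lker (form_lfun (l i)))%VS.

Lemma linealityP x v :
  reflect (forall i, l i x = b i -> l i v = 0) (v \in lineality x).
Proof.
apply: (iffP idP) => [|h].
  rewrite memvE => /subv_bigcapP h i /eqP/h.
  by rewrite -memvE memv_ker form_lfunE => /eqP.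
rewrite memvE; apply/subv_bigcapP => i /eqP/h lv.
by rewrite -memvE memv_ker form_lfunE lv.
Qed.

(** Moving along [lineality x] keeps active every constraint active at [x]. *)
Lemma lineality_sub x y : y - x \in lineality x ->
  (lineality y <= lineality x)%VS.
Proof.
move/linealityP => yx; apply/subvP => v /linealityP vy; apply/linealityP => i ix.
by apply: vy; rewrite -[y](subrK x) linearD yx // add0r.
Qed.

Lemma polyhedron_step x v : P x -> (forall i, l i x = b i -> l i v <= 0) ->
  exists2 e : R, 0 < e & P (x + e *: v) /\
    forall i, l i (x + e *: v) = b i -> l i x = b i /\ l i v = 0.
Proof.
move=> Px vx.
(* The inverse of one plus a sum lies below every ratio of slack to speed at once; active
   constraints contribute zero, division by zero being zero. *)
pose e := (1 + \sum_i `|l i v| / (b i - l i x))^-1.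
have s0 i : 0 <= `|l i v| / (b i - l i x).
  by rewrite divr_ge0 // subr_ge0 Px.
have D0 : 0 < 1 + \sum_i `|l i v| / (b i - l i x).
  by rewrite ltr_wpDr ?ltr01 // sumr_ge0.
have e0 : 0 < e by rewrite invr_gt0.
have inact i : l i x <> b i -> l i x + e * l i v < b i.
  move=> ix; have gap : 0 < b i - l i x.
    by rewrite subr_gt0 lt_neqAle Px andbT; apply/eqP.
  rewrite addrC -ltrBrDr; apply: le_lt_trans (_ : e * `|l i v| < _).
    by rewrite ler_pM2l // ler_norm.
  rewrite /e mulrC ltr_pdivrMr // mulrC -ltr_pdivrMr //.
  rewrite (bigD1 i) //= [X in _ < X]addrCA ltrDl ltr_wpDr ?ltr01 //.
  by rewrite sumr_ge0.
exists e => //; split=> [i|i]; rewrite linearD linearZ /=.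
  have [ix|/eqP/inact/ltW//] := eqVneq (l i x) (b i).
  by rewrite ix gerDl pmulr_rle0 // vx.
have [ix|/eqP/inact h] := eqVneq (l i x) (b i); last by move=> e1; rewrite e1 ltxx in h.
by rewrite ix => /eqP; rewrite addrC -subr_eq0 addrK mulf_eq0 gt_eqF //= => /eqP.
Qed.

Lemma lineality_step x v : P x -> v \in lineality x ->
  exists2 e : R, 0 < e & P (x + e *: v).
Proof.
move=> Px /linealityP vx.
have [|e e0 [Pe _]] := @polyhedron_step x v Px; last by exists e.
by move=> i /vx ->.
Qed.

(** Ratio test: the motion stops at the first constraint reached, and [v] is not tangent to that
    constraint. *)
Lemma polyhedron_exit x v : P x -> v \in lineality x -> (exists i, 0 < l i v) ->
  exists2 t : R, 0 < t & P (x + t *: v) /\ v \notin lineality (x + t *: v).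
Proof.
move=> Px /linealityP vx [i0 hi0].
pose F i := (b i - l i x) / l i v.
have [k hk kmin] := @arg_minP _ R _ i0 (fun i => 0 < l i v) F hi0.
have gap i : 0 < l i v -> 0 < b i - l i x.
  move=> lv; rewrite subr_gt0 lt_neqAle Px andbT; apply/eqP => /vx e.
  by rewrite e ltxx in lv.
have F0 : 0 < F k by rewrite divr_gt0 // gap.
exists (F k) => //; split=> [i|].
  rewrite linearD linearZ /=; have [lv|lv] := ltP 0 (l i v).
    by rewrite addrC -lerBrDr -ler_pdivlMr // kmin.
  by apply: le_trans (Px i); rewrite gerDl pmulr_rle0.
apply/linealityP => /(_ k); rewrite linearD linearZ /= divfK ?gt_eqF //.
by rewrite addrC subrK => /(_ erefl) e; rewrite e ltxx in hk.
Qed.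

(* Among the directions of [lineality x] pointing into the cone of [P] at [y],
   [u + tau w] is on the boundary of that cone, without being in
   [lineality y]. *)
Lemma polyhedron_between x y : P x -> P y -> y - x \in lineality x ->
  (\dim (lineality y) + 1 < \dim (lineality x))%N ->
  exists z, [/\ P z, z - x \in lineality x,
    (\dim (lineality y) < \dim (lineality z))%N &
    (\dim (lineality z) < \dim (lineality x))%N].
Proof.
move=> Px Py yx dyx; pose w := x - y.
have wx : w \in lineality x by rewrite /w -opprB memvN.
(* The gap of at least two in dimension leaves room for a direction outside [lineality y] and the
   line of [w]. *)
have [u ux uyw] : exists2 u, u \in lineality x & u \notin (lineality y + <[w]>)%VS.
  apply/subvPn; apply/negP => /dimvS h.
  have [+ _] := dimv_add_leqif (lineality y) <[w]>%VS; rewrite dim_vline.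
  by move: h dyx; case: (w != 0) => /=; lia.
have wneg i : l i y = b i -> l i x <> b i -> l i w < 0.
  by move=> iy /eqP ix; rewrite /w linearB /= iy subr_lt0 lt_neqAle ix Px.
pose I i := (l i y == b i) && (l i x != b i).
have [i0 Ii0] : exists i, I i.
  apply/existsP; apply: contraT; rewrite negb_exists => /forallP noI.
  have : (lineality x <= lineality y)%VS.
    apply/subvP => v /linealityP vx; apply/linealityP => i iy; apply: vx.
    by apply/eqP; have := noI i; rewrite /I iy eqxx negbK.
  by move/dimvS; lia.
(* The largest ratio is the least multiple of [w] that brings [u] into the cone; the constraint [k]
   attaining it becomes tight. *)
pose F i := l i u / (- l i w).
have [k Ik kmax] := @arg_maxP _ R _ i0 I F Ii0.
pose v := u + F k *: w.
have vx : v \in lineality x by rewrite memvD // memvZ.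
have lI i : I i -> l i w < 0 by case/andP => /eqP iy /eqP; exact: wneg.
have lv i : I i -> l i v = (- l i w) * (F i - F k).
  move=> Ii; have Fi : F i * (- l i w) = l i u.
    by rewrite divfK // oppr_eq0 lt_eqF // lI.
  by rewrite /v linearD linearZ /= -Fi; ring.
have vy i : l i y = b i -> l i v <= 0.
  move=> iy; have [ix|/eqP ix] := eqVneq (l i x) (b i).
    by move/linealityP: vx => ->.
  have Ii : I i by rewrite /I iy eqxx; apply/eqP.
  by rewrite lv // pmulr_rle0 ?oppr_gt0 ?lI // subr_le0; exact: kmax.
have vNy : v \notin lineality y.
  apply: contra uyw => vy'; rewrite -[u](addrK (F k *: w)).
  by rewrite memv_add // memvN memvZ ?memv_line.
have [e e0 [Pz zact]] := polyhedron_step Py vy.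
exists (y + e *: v); set z := y + e *: v in Pz zact *.
have zx : z - x \in lineality x by rewrite /z addrAC memvD // memvZ.
have vz : v \in lineality z by apply/linealityP => i /zact[].
have yz : (lineality y <= lineality z)%VS.
  apply/subvP => s /linealityP sy; apply/linealityP => i /zact[iy _].
  exact: sy.
have dlt (A B : {vspace E}) s : (A <= B)%VS -> s \in B -> s \notin A ->
    (\dim A < \dim B)%N.
  move=> AB sB sA; rewrite ltn_neqAle (dimvS AB) andbT; apply: contra sA => dAB.
  by have /eqP -> : A == B by rewrite eqEdim AB (eqP dAB) leqnn.
split=> //; first exact: dlt yz vz vNy.
(* [w] separates the two spaces: constraint [k] is active at [z], while [l k w < 0]. *)
apply: (dlt _ _ w (lineality_sub zx) wx).
apply/linealityP => /(_ k); rewrite linearD linearZ /= lv // subrr mulr0 mulr0 addr0.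
have /andP[/eqP ky _] := Ik; move=> /(_ ky) kw.
by have := lI k Ik; rewrite kw ltxx.
Qed.

(** An exit point gives some smaller face; as long as its codimension exceeds one,
    [polyhedron_between] replaces it by a larger one that is still proper. *)
Lemma polyhedron_facet x : P x -> (0 < \dim (lineality x))%N ->
  (forall v, v \in lineality x -> v != 0 -> exists i, 0 < l i v) ->
  exists y, [/\ P y, y - x \in lineality x &
    (\dim (lineality y) + 1 = \dim (lineality x))%N].
Proof.
move=> Px d0 noray.
pose Q y := [/\ P y, y - x \in lineality x &
  (\dim (lineality y) < \dim (lineality x))%N].
suff climb m y : Q y -> (\dim (lineality x) - \dim (lineality y) <= m)%N ->
    exists y', Q y' /\ (\dim (lineality y') + 1 = \dim (lineality x))%N.
  have [v vx v0] : exists2 v, v \in lineality x & v != 0.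
    have : lineality x != 0%VS by rewrite -dimv_eq0 -lt0n.
    rewrite -subv0 => /subvPn[v vx]; rewrite memv0 => v0; by exists v.
  have [t t0 [Py vy]] := polyhedron_exit Px vx (noray v vx v0).
  have yx : x + t *: v - x \in lineality x by rewrite addrAC subrr add0r memvZ.
  have [|y' [[Py' y'x _] dy']] := climb (\dim (lineality x)) (x + t *: v) _ (leq_subr _ _).
    split=> //; rewrite ltn_neqAle (dimvS (lineality_sub yx)) andbT.
    apply: contra vy => d; have /eqP -> // : lineality (x + t *: v) == lineality x.
    by rewrite eqEdim (lineality_sub yx) (eqP d) leqnn.
  by exists y'.
elim: m y => [|m IH] y [Py yx dy] dm; first by move: dm dy; lia.
have [e|ne] := eqVneq (\dim (lineality y) + 1)%N (\dim (lineality x)).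
  by exists y.
have dyx : (\dim (lineality y) + 1 < \dim (lineality x))%N.
  by rewrite ltn_neqAle ne addn1.
have [z [Pz zx yz dzx]] := polyhedron_between Px Py yx dyx.
by apply: (IH z) => //; lia.
Qed.

(** Induction on the number of active constraints: if [z] makes one of them strict, the midpoint of
    [x0] and [z] has fewer. *)
Lemma polyhedron_relint x0 : P x0 ->
  exists2 x, P x & forall z, P z -> z - x \in lineality x.
Proof.
pose act x := #|[set i | l i x == b i]%SET|.
have [m] := ubnP (act x0); elim: m x0 => // m IH x0 hm Px0.
have [h|] := pselect (forall z, P z -> z - x0 \in lineality x0); first by exists x0.
move=> /existsNP[z /not_implyP[Pz /negP zx]].
have {zx} [i [ix iz]] : exists i, l i x0 = b i /\ l i z <> b i.
  apply: contrapT => h; move/negP: zx; apply; apply/linealityP => i ix.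
  rewrite linearB /= ix; apply/eqP; rewrite subr_eq0; apply/eqP.
  by apply: contrapT => iz; apply: h; exists i.
pose y := 2^-1 *: x0 + 2^-1 *: z.
have ly j : l j y = (l j x0 + l j z) / 2.
  by rewrite /y linearD !linearZ /=; lra.
apply: (IH y) => [|j]; last by rewrite ly; have := Px0 j; have := Pz j; lra.
apply: (@leq_trans (act x0)); last by rewrite -ltnS.
apply: proper_card; apply/properP; split.
  apply/fintype.subsetP => j; rewrite !inE ly => /eqP; have := Px0 j; have := Pz j.
  by move=> *; apply/eqP; lra.
exists i; rewrite !inE ?ix // ly ix; apply/eqP; have := Pz i.
by rewrite le_eqVlt => /orP[/eqP//|]; lra.
Qed.

End Polyhedron.

(** * Gram matrices of rank two with a common square *)

Lemma oppr_gram (R : comNzRingType) m n (M : 'M[R]_(m, n)) :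
  (- M)^T *m (- M) = M^T *m M.
Proof. by rewrite (raddfN (@trmx R m n)) mulNmx mulmxN opprK. Qed.

Section RankTwo.
Variables (R : realType) (n : nat).

(** Rotating the two rows of [B] so that one points along [c B] does not change [B^T B]; [a] is the
    inverse squared length of [c], and [q] comes from the direction orthogonal to [c]. *)
Lemma gram_rank2_repr (B : 'M[R]_(2, n)) (c : 'rV[R]_2) : c != 0 ->
  exists (a : R) (q : 'rV[R]_n), B^T *m B = a *: ((c *m B)^T *m (c *m B)) + q^T *m q.
Proof.
move=> c0; pose s := c 0 0 ^+ 2 + c 0 1 ^+ 2.
have s0 : 0 < s.
  rewrite lt_neqAle addr_ge0 ?sqr_ge0 // andbT eq_sym.
  apply: contra c0 => /eqP; rewrite /s => s0.
  apply/eqP/rowP => i; rewrite mxE.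
  have [c00 c01] : c 0 0 = 0 /\ c 0 1 = 0 by split; nra.
  by case: i => -[|[|//]] hi; [rewrite -c00 | rewrite -c01]; congr (c _ _); apply: val_inj.
pose r := Num.sqrt s^-1; have rr : r ^+ 2 = s^-1 by rewrite sqr_sqrtr // invr_ge0 ltW.
exists s^-1, (r *: (c 0 0 *: row 1 B - c 0 1 *: row 0 B)).
apply/matrixP => i j; rewrite !mxE !big_ord_recl !big_ord0 !mxE.
rewrite !big_ord_recl !big_ord0 /=.
have -> : lift ord0 ord0 = 1 :> 'I_2 by apply: val_inj.
set x := B 0 i; set y := B 0 j; set z := B 1 i; set w := B 1 j.
transitivity (s^-1 * s * (x * y + z * w)).
  by rewrite mulVf ?gt_eqF // mul1r addr0.
rewrite -rr /s; ring.
Qed.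

(** Four rows of rank at most three satisfy a relation [c B + c' B' = 0], so [p = c B] lies in both
    row spaces. *)
Lemma common_square (B B' : 'M[R]_(2, n)) : (\rank (col_mx B B') <= 3)%N ->
  exists (p q t : 'rV[R]_n) (a b : R),
    B^T *m B = a *: (p^T *m p) + q^T *m q /\
    B'^T *m B' = b *: (p^T *m p) + t^T *m t.
Proof.
move=> rk.
have : kermx (col_mx B B') != 0.
  by rewrite -mxrank_eq0 mxrank_ker -lt0n subn_gt0; apply: leq_ltn_trans rk _.
case/rowV0Pn => v /sub_kermxP; rewrite -[v]hsubmxK mul_row_col.
set c := lsubmx v; set c' := rsubmx v => cB v0.
have cBE : c' *m B' = - (c *m B) by apply/eqP; rewrite -addr_eq0 addrC cB.
(* When one half of the relation is zero, [p] is the first row of the matrix on that side, and the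
   other matrix uses it with coefficient zero. *)
have [c'0|c'0] := eqVneq c' 0.
  have c0 : c != 0 by apply: contra v0 => /eqP c0; rewrite c0 c'0 row_mx0.
  have [a [q ->]] := gram_rank2_repr B c0.
  have e0 : delta_mx 0 0 != 0 :> 'rV[R]_2.
    by apply/rV0Pn; exists 0; rewrite mxE eqxx oner_eq0.
  have [b [t ->]] := gram_rank2_repr B' e0.
  have -> : c *m B = 0.
    by move: cBE; rewrite c'0 mul0mx => /eqP; rewrite eq_sym oppr_eq0 => /eqP.
  exists (delta_mx 0 0 *m B'), q, t, 0, b.
  by rewrite mulmx0 scaler0 scale0r.
have [b [t ->]] := gram_rank2_repr B' c'0; rewrite cBE.
have [c0|c0] := eqVneq c 0.
  have e0 : delta_mx 0 0 != 0 :> 'rV[R]_2.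
    by apply/rV0Pn; exists 0; rewrite mxE eqxx oner_eq0.
  have [a [q ->]] := gram_rank2_repr B e0.
  exists (delta_mx 0 0 *m B), q, t, a, 0.
  by rewrite c0 mul0mx oppr0 mulmx0 scaler0 scale0r.
have [a [q ->]] := gram_rank2_repr B c0.
exists (c *m B), q, t, a, b; split=> //.
by rewrite oppr_gram.
Qed.

End RankTwo.

(** * Proper polyhedral faces of the Gram spectrahedron *)

Section PolyhedralFace.
Variables (R : realType) (d : nat) (f : bform R (2 * d)).
Variables (n : nat) (l : 'I_n -> {scalar tensor2 R d}) (b : 'I_n -> R).
Implicit Types x y z N : tensor2 R d.

Let F : set (tensor2 R d) := [set x | forall i, l i x <= b i].
Hypothesis faceF : is_face (Gram f) F.
Hypothesis properF : F `<` Gram f.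

Let L := lineality l b.

Lemma face_qpsd x : F x -> qpsd x /\ mu x = f.
Proof. by case: faceF => sub _ _ /sub /GramP. Qed.

(** A direction of the face joins psd tensors on both sides of [x], hence has its support in that of
    [x]. Conversely [x] can be perturbed both ways inside [Gram f], and the face property keeps both
    points in [F]. *)
Lemma face_linealityP x N : F x ->
  N \in L x <-> [/\ N^T = N, (N <= x)%MS & mu N = 0].
Proof.
move=> Fx; have [xp xf] := face_qpsd Fx; split=> [NL|[Ns Nx N0]].
  have [e e0 Fe] := lineality_step Fx NL.
  have NL' : - N \in L x by rewrite memvN.
  have [e' e'0 Fe'] := lineality_step Fx NL'.
  have [pe fe] := face_qpsd Fe; have [pe' _] := face_qpsd Fe'.
  have NE : N = e^-1 *: ((x + e *: N) - x).
    by rewrite addrAC subrr add0r scalerA mulVf ?gt_eqF // scale1r.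
  split.
  - by rewrite NE linearZ linearB /=; case: pe => -> _; case: xp => -> _.
  - have := qpsd_addl_sub pe (qpsdZ (ltW (divr_gt0 e0 e'0)) pe').
    (* The weight [e / e'] cancels [N] and leaves a multiple of [x]. *)
    have -> : x + e *: N + (e / e') *: (x + e' *: - N) = (1 + e / e') *: x.
      rewrite scalerDr scalerA divfK ?gt_eqF // scalerN scalerDl scale1r.
      by rewrite addrACA subrr addr0.
    move=> h; rewrite NE scalemx_sub // addmx_sub ?eqmx_opp //.
    by apply: submx_trans h _; rewrite scalemx_sub.
  - by rewrite NE linearZ linearB /= fe xf subrr scaler0.
have [e e0 [pe pe']] := qpsd_perturb xp Ns Nx.
have muE s : mu (x + s *: N) = f by rewrite linearD linearZ /= N0 scaler0 addr0 xf.
have Ge : Gram f (x + e *: N) by apply/GramP.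
have Ge' : Gram f (x - e *: N) by apply/GramP; split=> //; rewrite -scaleNr.
have [_ _ /(_ _ _ 2^-1 Ge Ge')] := faceF.
have -> : 2^-1 *: (x + e *: N) + (1 - 2^-1) *: (x - e *: N) = x.
  have -> : 1 - 2^-1 = 2^-1 :> R by lra.
  rewrite -scalerDr addrACA subrr addr0 -mulr2n -scaler_nat scalerA.
  by rewrite mulVf ?pnatr_eq0 // scale1r.
have h1 : 0 < 2^-1 :> R by lra. have h2 : 2^-1 < 1 :> R by lra.
move=> /(_ h1 h2 Fx) [Fe Fe']; apply/linealityP => i ix.
have := Fe i; have := Fe' i; rewrite linearB linearD linearZ /= ix => u v.
have /eqP : e * l i N = 0 by lra.
by rewrite mulf_eq0 gt_eqF //= => /eqP.
Qed.

(** Otherwise the ray from [x] along [N] would stay in the face, making [N] psd; but a psd tensor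
    killed by [mu] is zero. *)
Lemma face_no_ray x N : F x -> N \in L x -> N != 0 -> exists i, 0 < l i N.
Proof.
move=> Fx NL; have [Ns _ N0] := (face_linealityP N Fx).1 NL.
apply: contra_neqP => noi; apply: qpsd_tpoly_eq0; last first.
  by rewrite -[RHS](linear0 (@tpoly R d)); apply: mu_eq_tpoly; rewrite linear0.
split=> // v; rewrite leNgt; apply/negP => neg.
have Nle i : l i N <= 0 by rewrite leNgt; apply/negP => h; apply: noi; exists i.
have [[_ xp] _] := face_qpsd Fx.
pose a := (v *m x *m v^T) 0 0; pose c := (v *m N *m v^T) 0 0.
have c0 : c < 0 by [].
(* Chosen so that the form of [x + t N] at [v] equals [-1]. *)
pose t := (a + 1) / - c.
have t0 : 0 <= t by rewrite divr_ge0 ?addr_ge0 ?ler01 ?xp // oppr_ge0 ltW.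
have Ft : F (x + t *: N).
  move=> i; rewrite linearD linearZ /=; apply: le_trans (Fx i).
  by rewrite gerDl mulr_ge0_le0.
have [[_ tp] _] := face_qpsd Ft; have := tp v.
rewrite mulmxDr mulmxDl -scalemxAr -scalemxAl mxE [X in _ + X]mxE -/a -/c.
have -> : t * c = - (a + 1) by rewrite /t invrN mulrN mulNr divfK // lt_eqF.
by lra.
Qed.

(** At full rank every [z] in [Gram f] gives a direction [x - z] of the face, so [x] lies strictly
    between [z] and a point of [F]; then [F] is all of [Gram f]. *)
Lemma face_rank_le x : F x -> (\rank x <= d)%N.
Proof.
move=> Fx; rewrite -ltnS ltn_neqAle rank_leq_col andbT; apply/negP => full.
case: properF => _; apply => z Gz.
have [[zs _] zf] := (GramP f z).1 Gz; have [[xs _] xf] := face_qpsd Fx.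
have : x - z \in L x.
  apply/face_linealityP => //; split; first by rewrite linearB /= xs zs.
    by apply: submx_full; rewrite /row_full.
  by rewrite linearB /= xf zf subrr.
move=> xz; have [e e0 Fe] := lineality_step Fx xz.
have e1 : 0 < 1 + e by lra.
have [sub _ face] := faceF.
have [|||Fz _] := face z (x + e *: (x - z)) (e / (1 + e)) Gz (sub _ Fe).
- by rewrite divr_gt0.
- by rewrite ltr_pdivrMr // mul1r; lra.
- suff -> : (e / (1 + e)) *: z + (1 - e / (1 + e)) *: (x + e *: (x - z)) = x by [].
  have -> : 1 - e / (1 + e) = (1 + e)^-1 by field; rewrite gt_eqF.
  apply: (scalerI (lt0r_neq0 e1)); rewrite scalerDr !scalerA mulrC divfK ?gt_eqF //.
  by rewrite divff ?gt_eqF // scale1r scalerBr addrCA subrKC scalerDl scale1r.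
- exact: Fz.
Qed.

(** Equal ranks would give equal row spaces, and the lineality space depends on the tensor only
    through its row space. *)
Lemma face_sub_rank x y : F x -> F y -> y - x \in L x ->
  (\dim (L y) < \dim (L x))%N -> (\rank y < \rank x)%N.
Proof.
move=> Fx Fy yx dyx; have [_ yxx _] := (face_linealityP _ Fx).1 yx.
have sub : (y <= x)%MS by rewrite -[y](subrK x) addmx_sub.
rewrite ltn_neqAle (mxrankS sub) andbT; apply: contraL dyx => rk.
have xy : (x <= y)%MS by rewrite -(geq_leqif (mxrank_leqif_sup sub)) (eqP rk).
rewrite -leqNgt; apply: dimvS; apply/subvP => N.
case/(face_linealityP _ Fx) => Ns Nx N0; apply/face_linealityP => //.
by split=> //; exact: submx_trans Nx xy.
Qed.

Lemma face_edge_ends x : F x -> \dim (L x) = 1%N ->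
  exists y y', [/\ F y, F y', y != y' &
    [/\ (\rank y < \rank x)%N, (\rank y' < \rank x)%N, (y <= x)%MS & (y' <= x)%MS]].
Proof.
move=> Fx d1.
have [N NL N0] : exists2 N, N \in L x & N != 0.
  have : L x != 0%VS by rewrite -dimv_eq0 d1.
  by rewrite -subv0 => /subvPn[v vx]; rewrite memv0 => v0; exists v.
have ends N' : N' \in L x -> N' != 0 -> exists2 t, 0 < t &
    [/\ F (x + t *: N'), (\rank (x + t *: N')%R < \rank x)%N & ((x + t *: N')%R <= x)%MS].
  move=> N'L N'0; have [t t0 [Ft Nt]] := polyhedron_exit Fx N'L (face_no_ray Fx N'L N'0).
  have tL : x + t *: N' - x \in L x by rewrite addrAC subrr add0r memvZ.
  exists t => //; split=> //; last first.
    by have [_ N'x _] := (face_linealityP _ Fx).1 N'L; rewrite addmx_sub ?scalemx_sub.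
  apply: face_sub_rank => //.
  rewrite ltn_neqAle (dimvS (lineality_sub tL)) andbT; apply: contra Nt => dd.
  have /eqP -> // : lineality l b (x + t *: N') == L x.
  by rewrite eqEdim (lineality_sub tL) (eqP dd) leqnn.
have [t t0 [F1 r1 s1]] := ends N NL N0.
have [||t' t'0 [F2 r2 s2]] := ends (- N); rewrite ?memvN ?oppr_eq0 //.
exists (x + t *: N), (x + t' *: - N); split=> //.
rewrite (inj_eq (addrI x)) -subr_eq0 scalerN opprK -scalerDl scaler_eq0 negb_or N0.
by rewrite andbT gt_eqF // addr_gt0.
Qed.

(* The rank-two tensors at the two ends of an edge of rank three have a common
   vector in their supports, so they differ from each other by a multiple of one
   square [p^2] up to one further square each. *)
Lemma face_edge_rank x : F x -> \dim (L x) = 1%N -> (\rank x <= 3)%N ->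
  (3 <= d)%N /\
  exists (g u v : {poly R}) (k : R),
    [/\ g \is monic, ((size g).-1 <= d)%N,
        (size u <= ((d - (size g).-1)./2).+1)%N,
        (size v <= ((d - (size g).-1)./2).+1)%N &
        tpoly x = pencil_form g u v k%:P].
Proof.
move=> Fx d1 r3.
have [y [y' [Fy Fy' yy' [ry ry' yx y'x]]]] := face_edge_ends Fx d1.
have [yp yf] := face_qpsd Fy; have [y'p y'f] := face_qpsd Fy'.
have [_ xf] := face_qpsd Fx.
have yy'p : tpoly y = tpoly y' by apply: mu_eq_tpoly; rewrite yf y'f.
(* In a domain a square determines its root up to sign, so a rank-one tensor is determined by its
   polynomial. *)
have sqr_inj (q t : 'rV[R]_d.+1) : rVpoly q ^+ 2 = rVpoly t ^+ 2 -> q^T *m q = t^T *m t.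
  move/eqP; rewrite eqf_sqr => /orP[/eqP/(can_inj rVpolyK) -> //|].
  rewrite -linearN => /eqP/(can_inj rVpolyK) ->.
  by rewrite oppr_gram.
split.
  (* If [d <= 2], both ends have rank at most one and the same polynomial, so they coincide. *)
  rewrite leqNgt; apply: contra yy' => d2; have rd := face_rank_le Fx.
  have [|u yu] := @cholesky _ _ 1 _ yp; first by rewrite -ltnS (leq_trans ry) // (leq_trans rd).
  have [|w yw] := @cholesky _ _ 1 _ y'p; first by rewrite -ltnS (leq_trans ry') // (leq_trans rd).
  by rewrite yu yw; apply/eqP/sqr_inj; rewrite !expr2 -!tpoly_rank1 -yu -yw yy'p.
have [|B yB] := @cholesky _ _ 2 _ yp; first by rewrite -ltnS (leq_trans ry).
have [|B' y'B] := @cholesky _ _ 2 _ y'p; first by rewrite -ltnS (leq_trans ry').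
have [|p [q [t [a [c [ya y'c]]]]]] := @common_square _ _ B B'.
  apply: leq_trans r3; apply: mxrankS; rewrite col_mx_sub.
  apply/andP; split; [apply: submx_trans yx|apply: submx_trans y'x].
    by rewrite yB gram_row_space.
  by rewrite y'B gram_row_space.
rewrite -{}yB in ya; rewrite -{}y'B in y'c.
have tE s (w z : 'rV[R]_d.+1) : tpoly (s *: (w^T *m w) + z^T *m z) =
    s%:P * rVpoly w ^+ 2 + rVpoly z ^+ 2.
  by rewrite linearD linearZ /= !tpoly_rank1 -!expr2 mul_polyC.
have [p0|p0] := eqVneq p 0.
  case/eqP: yy'; rewrite ya y'c p0 !mulmx0 !scaler0 !add0r; apply: sqr_inj.
  by move: yy'p; rewrite ya y'c !tE p0 linear0 expr0n /= !mulr0 !add0r.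
have [ac|ac] := eqVneq a c.
  case/eqP: yy'; rewrite ya y'c ac; congr (_ + _); apply: sqr_inj.
  by move: yy'p; rewrite ya y'c !tE ac => /addrI.
have P0 : rVpoly p != 0.
  by apply: contra_neq p0 => h; apply: (can_inj rVpolyK); rewrite h linear0.
have [|||g [u [v [k [gm sg su sv e]]]]] :=
  @two_representations R d (rVpoly p) (rVpoly q) (rVpoly t) a c ac P0.
- exact: size_poly.
- exact: size_poly.
- by rewrite -!tE -ya -y'c.
exists g, u, v, k; split=> //; rewrite -e -tE -ya.
by apply: mu_eq_tpoly; rewrite xf yf.
Qed.

(** The form of genericity used: [f] is no pencil form within the degree bounds. The premise
    [3 <= d] marks the case in which a hypersurface through these forms is built. *)
Hypothesis generic : forall (g u v : {poly R}) (k : R),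
  (3 <= d)%N -> g \is monic -> ((size g).-1 <= d)%N ->
  (size u <= ((d - (size g).-1)./2).+1)%N ->
  (size v <= ((d - (size g).-1)./2).+1)%N ->
  ~ forall i : 'I_(2 * d).+1, bcoef f i = (pencil_form g u v k%:P)`_i.

Lemma face_rank_ge x k : F x -> \dim (L x) = k.+1 -> (k.+4 <= \rank x)%N.
Proof.
elim: k x => [|k IH] x Fx dk.
  rewrite ltnNge; apply/negP => r3.
  have [d3 [g [u [v [c [gm sg su sv e]]]]]] := face_edge_rank Fx dk r3.
  apply: (generic d3 gm sg su sv (k := c)) => i.
  by rewrite -e tpoly_coef (face_qpsd Fx).2.
have [||y [Fy yx dy]] := @polyhedron_facet R _ n l b x Fx.
- by rewrite -/L dk.
- by move=> v; exact: face_no_ray.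
apply: leq_ltn_trans (face_sub_rank Fx Fy yx _); last by rewrite -dy addn1.
by apply: IH Fy _; apply: succn_inj; rewrite -dk -dy addn1.
Qed.

(** At a relative interior point the lineality space is the direction space of the affine hull. *)
Lemma face_has_dim k : has_dim F k -> exists2 x, F x & \dim (L x) = k.
Proof.
case=> x0 [U [hull dU]].
have Ux0 : affine_hull F x0 by rewrite hull /affine_subspace /= subrr mem0v.
have [[x1 Fx1]|F0] := pselect (exists x, F x); last first.
  (* An empty [F] lies in the single point [x0 - 1], so its affine hull would miss [x0]. *)
  have Fsub : F `<=` affine_subspace (x0 - 1%:M) 0%VS.
    by move=> z Fz; case: F0; exists z.
  have := Ux0 _ _ Fsub; rewrite /affine_subspace /= opprB addrC subrK memv0.
  move/eqP/matrixP/(_ 0 0)/eqP.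
  by rewrite !mxE eqxx oner_eq0.
have [x Fx relint] := polyhedron_relint Fx1.
exists x => //; rewrite -dU; congr (\dim _); apply/eqP; rewrite eqEsubv.
have FU z : F z -> z - x0 \in U.
  move=> Fz; suff : affine_hull F z by rewrite hull.
  by move=> z0 V; apply.
have hullL z : affine_hull F z -> z - x \in L x by apply => y; exact: relint.
apply/andP; split; apply/subvP => v vL.
  have [e e0 Fe] := lineality_step Fx vL.
  have -> : v = e^-1 *: ((x + e *: v - x0) - (x - x0)).
    by rewrite opprB addrA subrK addrAC subrr add0r scalerA mulVf ?gt_eqF // scale1r.
  by rewrite memvZ // memvB // FU.
have -> : v = (x0 + v - x) - (x0 - x) by rewrite opprB addrA subrK addrAC subrr add0r.
rewrite memvB // hullL // hull /affine_subspace /= addrAC subrr add0r //.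
Qed.

(** The dimension count and the rank bound give ['C(k + 4, 2) <= 2 d + 1 + k]; Pascal's rule removes
    [k + 3] from the left side. *)
Lemma face_dim_bound k : has_dim F k -> (1 <= k)%N ->
  ('C(k + 3, 2) <= 2 * d - 2)%N.
Proof.
case: k => // k /face_has_dim [x Fx dx] _.
have rk := face_rank_ge Fx dx; have [xp _] := face_qpsd Fx.
have : ('C((\rank x).+1, 2) <= (2 * d).+1 + \dim (L x))%N.
  by apply: rank_face_dim => // N Ns Nx N0; apply/face_linealityP.
have := leq_bin2l 2 (rk : (k.+4 < (\rank x).+1)%N); rewrite dx.
rewrite binS bin1 addSn !addnS addn0; lia.
Qed.

End PolyhedralFace.

Theorem proposition4p1 (R : realType) (d : nat) :
  generic_nonneg (fun f : bform R (2 * d) =>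
    forall (F : set (tensor2 R d)) (k : nat),
      is_face (Gram f) F -> F `<` Gram f ->
      polyhedron F -> has_dim F k -> (1 <= k)%N ->
      ('C(k + 3, 2) <= 2 * d - 2)%N).
Proof.
have [P P1 Pv] : exists2 P : {mpoly R[(2 * d).+1]}, (1 < msize P)%N &
    forall (g u v : {poly R}) (k : R), (3 <= d)%N ->
      g \is monic -> ((size g).-1 <= d)%N ->
      (size u <= ((d - (size g).-1)./2).+1)%N ->
      (size v <= ((d - (size g).-1)./2).+1)%N ->
      P.@[fun i => (pencil_form g u v k%:P)`_i] = 0.
  have [d3|d3] := leqP 3 d.
    have [P P1 Pv] := pencil_hypersurface R d3.
    by exists P => // g u v k _; exact: Pv.
  (* For [d < 3] the premise [3 <= d] fails, and any nonconstant polynomial serves. *)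
  by exists 'X_ord0 => [|g u v k]; rewrite ?msizeX ?mdeg1 // ltnNge d3.
exists [set f | P.@[bcoef f] = 0]; split; first by exists P.
move=> f [_ notbound]; apply: contrapT => Pf; apply: notbound.
move=> F k faceF properF [n [l [b FE]]]; rewrite {}FE in faceF properF *.
apply: face_dim_bound faceF properF _ k => g u v c d3 gm sg su sv fE.
by apply: Pf; rewrite /= -[RHS](Pv g u v c d3 gm sg su sv); apply: meval_eq.
Qed.
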